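(* Let $\boldsymbol\phi(n,m,\alpha,\beta,l)\in\mathbb C^N$ satisfy the condition equation set (for all arguments, only the indicated variable shifted) $\sigma_1\boldsymbol\phi(n-1,\cdot,l)=\boldsymbol\phi(n,\cdot,l)-\boldsymbol\phi(n-1,\cdot,l+1)$, $\sigma_2\boldsymbol\phi(m-1,\cdot,l)=\boldsymbol\phi(m,\cdot,l)-\boldsymbol\phi(m-1,\cdot,l+1)$, $\sigma_3\boldsymbol\phi(\alpha-1,\cdot,l)=\boldsymbol\phi(\alpha,\cdot,l)-\boldsymbol\phi(\alpha-1,\cdot,l+1)$, $\sigma_4\boldsymbol\phi(\beta-1,\cdot,l)=\boldsymbol\phi(\beta,\cdot,l)-\boldsymbol\phi(\beta-1,\cdot,l+1)$, and $\boldsymbol K\boldsymbol\phi(l)=\boldsymbol\phi(l+4)-\epsilon_1\boldsymbol\phi(l+3)+\epsilon_2\boldsymbol\phi(l+2)-\epsilon_3\boldsymbol\phi(l+1)$ for a constant $N\times N$ matrix $\boldsymbol K$. Let $f'=|0,\dots,N-1|$, $g'=|0,\dots,N-2,N|$, $h'=|0,\dots,N-2,N+1|$, $s'=|0,\dots,N-3,N-1,N|$ (Casoratians of $\boldsymbol\phi$). Then $$\widetilde f'(\sigma_1\dot f'+\dot g')-(\sigma_1-\sigma_4)f'\widetilde{\dot f}'-(\sigma_4\widetilde f'+\widetilde g')\dot f'=0,\quad \widehat f'(\sigma_2\dot f'+\dot g')-(\sigma_2-\sigma_4)f'\widehat{\dot f}'-(\sigma_4\widehat f'+\widehat g')\dot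 f'=0,$$ $$\widetilde f'(\sigma_4^2\dot f'-\sigma_4\dot g'+\dot h')+\sigma_1\widetilde f'(\dot g'-\sigma_4\dot f')-(\sigma_1-\sigma_4)f'(\widetilde{\dot g}'-\sigma_4\widetilde{\dot f}')-\dot f'\widetilde h'=0,$$ $$\widehat f'(\sigma_4^2\dot f'-\sigma_4\dot g'+\dot h')+\sigma_2\widehat f'(\dot g'-\sigma_4\dot f')-(\sigma_2-\sigma_4)f'(\widehat{\dot g}'-\sigma_4\widehat{\dot f}')-\dot f'\widehat h'=0,$$ $$\widetilde f'(\sigma_1g'+h')-\widetilde g'(\sigma_1f'+g')+f'\widetilde s'=0,\qquad \widehat f'(\sigma_2g'+h')-\widehat g'(\sigma_2f'+g')+f'\widehat s'=0,$$ $$(\sigma_1-\sigma_2)(\widetilde f'\widehat f'-f'\widehat{\widetilde f}')+\widetilde f'\widehat g'-\widehat f'\widetilde g'=0,$$ $$\big[Q(\sigma_1,\sigma_2)f'\widehat{\widetilde{\dot f}}'+s'\widehat{\widetilde{\dot f}}'+(\sigma_1+\sigma_2+\epsilon_1)g'\widehat{\widetilde{\dot f}}'-((\sigma_1+\sigma_2+\epsilon_1)f'+g')(\widehat{\widetilde{\dot g}}'-\sigma_4\widehat{\widetilde{\dot f}}')+f'(\widehat{\widetilde{\dot h}}'-\sigma_4\widehat{\widetilde{\dot g}}'+\sigma_4^2\widehat{\widetilde{\dot f}}')\big](\sigma_1-\sigma_2)-R(\sigma_1,\sigma_4)\widetilde f'\widehat{\dot f}'+R(\sigma_2,\sigma_4)\widehat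 f'\widetilde{\dot f}'=0.$$
   Context: Fix $\alpha_1,\alpha_2,\alpha_3,\delta\in\mathbb C$ and pairwise distinct $p,q,a,b\in\mathbb C$. Put $\sigma_1=p-\delta$, $\sigma_2=q-\delta$, $\sigma_3=a-\delta$, $\sigma_4=b-\delta$; $\epsilon_1=4\delta-\alpha_3$, $\epsilon_2=6\delta^2-3\delta\alpha_3+\alpha_2$, $\epsilon_3=4\delta^3-3\delta^2\alpha_3+2\delta\alpha_2-\alpha_1$; $Q(x,y)=(x+y)^2-xy+\epsilon_1(x+y)+\epsilon_2$; $R(x,y)=(x+y)(x^2+y^2)+\epsilon_1((x+y)^2-xy)+\epsilon_2(x+y)+\epsilon_3$. Casoratian notation: $|l_1,\dots,l_N|=\det(\boldsymbol\phi(l_1),\dots,\boldsymbol\phi(l_N))$ with $\boldsymbol\phi(l)=\boldsymbol\phi(n,m,\alpha,\beta,l)$; a run ''$0,\dots,j$'' with $j<0$ is empty, and if the listed indices number more than $N$ the symbol is $0$. Shifts: $\widetilde F=F(n+1,m,\beta)$, $\widehat F=F(n,m+1,\beta)$, $\dot F=F(n,m,\beta+1)$, composed as needed. *)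

(* Defs.v *)
From HB Require Import structures.
From mathcomp Require Import all_boot all_order all_algebra.
From mathcomp Require Import reals complex.
Set Implicit Arguments. Unset Strict Implicit. Unset Printing Implicit Defensive.
Import Order.TTheory GRing.Theory Num.Theory.
Local Open Scope ring_scope.

Section Defs.
Variable R : realType.
Local Notation C := (complex R).

Definition eps1 (alpha3 delta : C) : C := 4 * delta - alpha3.
Definition eps2 (alpha2 alpha3 delta : C) : C :=
  6 * delta ^+ 2 - 3 * delta * alpha3 + alpha2.
Definition eps3 (alpha1 alpha2 alpha3 delta : C) : C :=
  4 * delta ^+ 3 - 3 * delta ^+ 2 * alpha3 + 2 * delta * alpha2 - alpha1.

Definition Qpoly (e1 e2 x y : C) : C := (x + y) ^+ 2 - x * y + e1 * (x + y) + e2.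
Definition Rpoly (e1 e2 e3 x y : C) : C :=
  (x + y) * (x ^+ 2 + y ^+ 2) + e1 * ((x + y) ^+ 2 - x * y) + e2 * (x + y) + e3.

(* Casoratian |l_1,...,l_k| = det(phi(l_1),...,phi(l_k)) of the column vectors
   phi(n,m,alpha,beta,l) in C^N; it is 0 when the number of listed indices
   differs from N (only the case "more than N" occurs below). *)
Definition casor (N : nat) (phi : int -> int -> int -> int -> int -> 'cV[C]_N)
  (n m al be : int) (s : seq int) : C :=
  if size s == N then \det (\matrix_(i < N, j < N) phi n m al be (nth 0 s j) i 0)
  else 0.

Definition run (j : nat) : seq int := [seq (k%:Z) | k <- iota 0 j].

Definition fC N phi n m al be : C := @casor N phi n m al be (run N).
Definition gC N phi n m al be : C :=
  @casor N phi n m al be (run N.-1 ++ [:: N%:Z]).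
Definition hC N phi n m al be : C :=
  @casor N phi n m al be (run N.-1 ++ [:: N%:Z + 1]).
Definition sC N phi n m al be : C :=
  @casor N phi n m al be (run N.-2 ++ [:: N%:Z - 1; N%:Z]).
End Defs.

(* Main.v *)
Require Import Defs.
From HB Require Import structures.
From mathcomp Require Import all_boot all_order all_algebra.
From mathcomp Require Import reals complex.
From mathcomp Require boolp.
From mathcomp Require Import ring.
Import Order.TTheory GRing.Theory Num.Theory.
Local Open Scope ring_scope.

(* Extend [l |-> u l] to a linear map [Phi u] from polynomials to columns. Advancing
   one of the discrete variables multiplies the polynomial by ['X + s], and [K]
   acts as multiplication by a quartic, so [K] preserves the kernel of [Phi u].
   By Cramer's rule the signed maximal minors of [u 0, ..., u N] form a
   polynomial [kpoly u] in this kernel; its top coefficients are f, -g, s up to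
   sign and its value at [- s] is the shifted f. Dividing [kpoly u], or its
   product with a quotient of the quartic, by the linear factors expresses 0 as
   a combination of columns at the shifted point, and inserting this relation
   into a determinant that lacks one column yields each bilinear identity. *)

(** * Determinants as functions of a family of columns *)

Section ColumnDet.
Set Implicit Arguments. Unset Strict Implicit. Unset Printing Implicit Defensive.
Variable R : comNzRingType.

(** All the column operations are done at once by right multiplication with the upper unitriangular
    matrix [U]. *)
Lemma det_col_step (n : nat) (A : 'I_n -> nat -> R) (t : nat -> R) :
  \det (\matrix_(i < n, j < n)
     (A i j + if val j is j'.+1 then t j * A i j' else 0)) =
  \det (\matrix_(i < n, j < n) A i j).
Proof.
pose U : 'M[R]_n := \matrix_(k, j) ((k == j)%:R + t j * (k.+1 == j :> nat)%:R).
have detU : \det U = 1.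
  (* Transposed because [det_trig] expects a lower triangular matrix. *)
  rewrite -det_tr det_trig.
    by apply: big1 => i _; rewrite !mxE eqxx gtn_eqF // mulr0 addr0.
  apply/is_trig_mxP => i j ltij; rewrite !mxE.
  have /negbTE -> : j != i by rewrite -val_eqE /= gtn_eqF.
  have /negbTE -> : (j.+1 != i)%N by rewrite gtn_eqF // ltnS ltnW.
  by rewrite mulr0 addr0.
rewrite -[RHS]mulr1 -detU -det_mulmx; congr (\det _).
apply/matrixP => i j; rewrite !mxE.
under eq_bigr => k _ do rewrite !mxE mulrDr.
rewrite big_split /=; congr (_ + _).
  rewrite (bigD1 j) //= eqxx mulr1 big1 ?addr0 // => k /negbTE ->.
  by rewrite mulr0.
case: j => [[|j] ltj] /=.
  by rewrite big1 // => k _; rewrite !mulr0.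
rewrite (bigD1 (Ordinal (ltnW ltj))) //= eqxx mulr1 mulrC big1 ?addr0 // => k nek.
have /negbTE -> : (k.+1 != j.+1)%N by rewrite eqSS -val_eqE in nek *.
by rewrite !mulr0.
Qed.

Variable N : nat.
Implicit Types (u c : nat -> 'cV[R]_N) (v : 'cV[R]_N) (Q : {poly R}).

(** The family runs over all of [nat], although only its first [N] columns count, so that shifting
    or skipping indices needs no bounds. *)
Definition cdet c : R := \det (\matrix_(i < N, j < N) c j i 0).

Definition upd c (k : nat) v : nat -> 'cV[R]_N :=
  fun j => if j == k then v else c j.

Lemma eq_cdet c1 c2 : (forall j, (j < N)%N -> c1 j = c2 j) -> cdet c1 = cdet c2.
Proof. by move=> eqc; congr (\det _); apply/matrixP => i j; rewrite !mxE eqc. Qed.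

Lemma cdet_alt c (j k : nat) :
  (j < N)%N -> (k < N)%N -> j != k -> c j = c k -> cdet c = 0.
Proof.
move=> ltj ltk nejk eqc; rewrite /cdet -det_tr.
apply: (determinant_alternate (i1 := Ordinal ltj) (i2 := Ordinal ltk)) => //.
by move=> i; rewrite !mxE /= eqc.
Qed.

(** The cofactors do not involve column [k], so linearity in [v] can be read off. *)
Lemma cdet_updE c (k : nat) (ltk : (k < N)%N) v :
  cdet (upd c k v) =
  \sum_i v i 0 * cofactor (\matrix_(i < N, j < N) c j i 0) i (Ordinal ltk).
Proof.
rewrite /cdet (expand_det_col _ (Ordinal ltk)); apply: eq_bigr => i _.
rewrite mxE /upd /= eqxx; congr (_ * (_ * \det _)).
apply/matrixP => i' j'; rewrite !mxE /=.
by have /negbTE -> : bump k j' != k by rewrite eq_sym neq_bump.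
Qed.

Lemma cdet_updD c k v1 v2 : (k < N)%N ->
  cdet (upd c k (v1 + v2)) = cdet (upd c k v1) + cdet (upd c k v2).
Proof.
move=> ltk; rewrite !(cdet_updE _ ltk) -big_split /=.
by apply: eq_bigr => i _; rewrite mxE mulrDl.
Qed.

Lemma cdet_updZ c k a v : (k < N)%N -> cdet (upd c k (a *: v)) = a * cdet (upd c k v).
Proof.
move=> ltk; rewrite !(cdet_updE _ ltk) mulr_sumr.
by apply: eq_bigr => i _; rewrite mxE mulrA.
Qed.

Lemma cdet_upd0 c k : (k < N)%N -> cdet (upd c k 0) = 0.
Proof. by move=> ltk; rewrite -(scale0r 0) cdet_updZ // mul0r. Qed.

Lemma cdet_upd_sum c k n (v : 'I_n -> 'cV[R]_N) : (k < N)%N ->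
  cdet (upd c k (\sum_i v i)) = \sum_i cdet (upd c k (v i)).
Proof.
move=> ltk; apply: (big_morph (fun v => cdet (upd c k v))); last by rewrite cdet_upd0.
by move=> v1 v2 /=; rewrite cdet_updD.
Qed.

(** The condition equations say that advancing a variable replaces phi(l) by phi(l+1) + s phi(l). *)
Definition colshift (s : R) u : nat -> 'cV[R]_N := fun l => u l.+1 + s *: u l.

(** Expanding both determinants along the column [c 0] gives the same minors, with signs differing
    by (-1)^k. *)
Lemma cdet_cyc c v (k : nat) : (k < N)%N ->
  cdet (fun j => if (j < k)%N then c j.+1 else if j == k then c 0%N else c j) =
  (-1) ^+ k * cdet c.
Proof.
move=> ltk; rewrite /cdet (expand_det_col _ (Ordinal ltk)).
rewrite (expand_det_col _ (Ordinal (leq_ltn_trans (leq0n k) ltk))) mulr_sumr.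
apply: eq_bigr => i _; rewrite !mxE /= ltnn eqxx /cofactor addn0 exprD.
rewrite [(_ ^+ i) * _]mulrC -!mulrA mulrCA; congr (_ * (_ * (_ * _))).
congr (\det _); apply/matrixP => i' j'; rewrite !mxE /= /bump /=.
have [lekj|ltjk] := leqP k j'; last by rewrite add0n add1n ltjk.
by rewrite add1n ltnNge leqW //= gtn_eqF.
Qed.

(* Since [colshift s u j = u (j+1) + s u j], column operations turn
   [u 0, colshift s u 0, ..., colshift s u (k-1)] into [u 0, ..., u k]. *)
Lemma cdet_colshift s u c (k : nat) : (k < N)%N ->
  cdet (fun j => if (j < k)%N then colshift s u j else if j == k then u 0%N else c j) =
  (-1) ^+ k * cdet (fun j => if (j <= k)%N then u j else c j).
Proof.
move=> ltk.
pose c1 j := if (j <= k)%N then (if j is j'.+1 then colshift s u j' else u 0%N) else c j.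
have -> : cdet (fun j => if (j <= k)%N then u j else c j) = cdet c1.
  rewrite /cdet -(det_col_step (fun i j => (if (j <= k)%N then u j else c j) i 0)
     (fun j => if (j <= k)%N then s else 0)).
  congr (\det _); apply/matrixP => i j; rewrite !mxE /c1.
  case: j => [[|j'] ltj] /=; first by rewrite addr0.
  case: (ltnP j' k) => [ltjk|_]; last by rewrite mul0r addr0.
  by rewrite (ltnW ltjk) /colshift !mxE.
rewrite -(cdet_cyc c1 0 ltk); apply: eq_cdet => j _; rewrite /c1 /=.
case: ltnP => // lekj; case: eqP => // /eqP nejk.
by rewrite leqNgt ltn_neqAle lekj eq_sym nejk.
Qed.

(** * Polynomials acting on columns *)

Definition Phi u (Q : {poly R}) : 'cV[R]_N := \sum_(i < size Q) Q`_i *: u i.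

Lemma PhiE n u Q : (size Q <= n)%N -> Phi u Q = \sum_(i < n) Q`_i *: u i.
Proof.
move=> leQn; rewrite /Phi (big_ord_widen n (fun i => Q`_i *: u i)) //.
rewrite big_mkcond; apply: eq_bigr => i _; case: ltnP => // leQi.
by rewrite nth_default // scale0r.
Qed.

Lemma PhiD u Q1 Q2 : Phi u (Q1 + Q2) = Phi u Q1 + Phi u Q2.
Proof.
pose n := maxn (size Q1) (size Q2).
rewrite !(@PhiE n) ?leq_maxl ?leq_maxr ?size_polyD // -big_split /=.
by apply: eq_bigr => i _; rewrite coefD scalerDl.
Qed.

Lemma PhiZ u a Q : Phi u (a *: Q) = a *: Phi u Q.
Proof.
rewrite (@PhiE (size Q) u (a *: Q)) ?size_scale_leq // scaler_sumr.
by apply: eq_bigr => i _; rewrite coefZ scalerA.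
Qed.

Lemma PhiB u Q1 Q2 : Phi u (Q1 - Q2) = Phi u Q1 - Phi u Q2.
Proof. by rewrite PhiD -scaleN1r PhiZ scaleN1r. Qed.

Lemma PhiC u a : Phi u a%:P = a *: u 0%N.
Proof. by rewrite (@PhiE 1) ?size_polyC_leq1 // big_ord1 coefC. Qed.

Lemma PhiMX u Q : Phi u (Q * 'X) = Phi (u \o succn) Q.
Proof.
rewrite (@PhiE (size Q).+1); last first.
  by rewrite (leq_trans (size_polyMleq _ _)) // size_polyX addn2.
rewrite big_ord_recl coefMX eqxx scale0r add0r.
by apply: eq_bigr => i _; rewrite coefMX.
Qed.

Lemma Phi_colshift s u Q : Phi u (Q * ('X + s%:P)) = Phi (colshift s u) Q.
Proof.
rewrite mulrDr PhiD PhiMX [Q * s%:P]mulrC mul_polyC PhiZ /Phi scaler_sumr -big_split.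
apply: eq_bigr => i _ /=.
by rewrite scalerDr !scalerA [s * _]mulrC.
Qed.

(** The remainder theorem, transported by [Phi_colshift]. The last clause is the recursion of
    synthetic division; it later yields the top coefficients of the quotient. *)
Lemma Phi_divXD s u Q n : (size Q <= n.+1)%N -> exists Q',
  [/\ Phi u Q = Q.[- s] *: u 0%N + Phi (colshift s u) Q', (size Q' <= n)%N &
      forall i, Q`_i.+1 = Q'`_i + s * Q'`_i.+1].
Proof.
move=> szQ; have /factor_theorem [Q' eqQ] : root (Q - Q.[- s]%:P) (- s).
  by rewrite /root hornerD hornerN hornerC subrr.
move: eqQ => /(canRL (subrK _)); rewrite polyCN opprK => eqQ.
exists Q'; split.
- by rewrite {1}eqQ PhiD PhiC Phi_colshift addrC.
- have [->|nz] := eqVneq Q' 0; first by rewrite size_poly0.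
  (* [R] may have zero divisors; the divisor being monic keeps the degree count exact. *)
  have sz : size (Q' * ('X + s%:P)) = (size Q').+1.
    by rewrite size_Mmonic ?monicXaddC // size_XaddC addn2.
  rewrite -ltnS -sz -(size_polyDl (q := Q.[- s]%:P)) -?eqQ // sz
    (leq_ltn_trans (size_polyC_leq1 _)) // ltnS.
  by rewrite lt0n size_poly_eq0.
- by move=> i; rewrite {1}eqQ coefD coefC addr0 mulrDr coefD coefMX coefMC mulrC.
Qed.

(** * The kernel polynomial of signed maximal minors *)

Definition kpoly u : {poly R} :=
  \poly_(i < N.+1) ((-1) ^+ i * cdet (u \o bump i)).

(** Used with two borders: a row of [u] for [Phi_kpoly], the powers of [- s] for [horner_kpoly]. *)
Lemma bordered_det (r : nat -> R) u :
  \det (\matrix_(i < N.+1, j < N.+1)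
          (if unlift ord0 i is Some k then u j k 0 else r j)) =
  \sum_(j < N.+1) (-1) ^+ j * cdet (u \o bump j) * r j.
Proof.
rewrite (expand_det_row _ ord0); apply: eq_bigr => j _.
rewrite mxE unlift_none mulrC /cofactor add0n; congr (_ * \det _ * _).
by apply/matrixP => i' j'; rewrite !mxE liftK.
Qed.

(** Coordinate [k] is a bordered determinant whose border repeats row [k], so two of its rows are
    equal. *)
Lemma Phi_kpoly u : Phi u (kpoly u) = 0.
Proof.
rewrite (@PhiE N.+1) ?size_poly //; apply/matrixP => k l; rewrite ord1 summxE mxE.
rewrite -[RHS](determinant_alternate (A := \matrix_(i < N.+1, j < N.+1)
  (if unlift ord0 i is Some k' then u j k' 0 else u j k 0))
  (i1 := ord0) (i2 := lift ord0 k)) ?neq_lift //; last first.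
  by move=> j; rewrite !mxE unlift_none liftK.
rewrite (bordered_det (fun j => u j k 0)); apply: eq_bigr => j _.
by rewrite coef_poly ltn_ord mxE.
Qed.

(** Adding [s] times each column to the next kills the border (-s)^j beyond its first entry and
    produces the columns of [colshift s u] below it. *)
Lemma horner_kpoly u s : (kpoly u).[- s] = cdet (colshift s u).
Proof.
rewrite horner_poly -(bordered_det (fun j => (- s) ^+ j)).
pose A (i : 'I_N.+1) j := if unlift ord0 i is Some k then u j k 0 else (- s) ^+ j.
rewrite -(det_col_step A (fun=> s)) (expand_det_row _ ord0) big_ord_recl.
rewrite big1 ?addr0 => [|j _]; last first.
  by rewrite mxE /A unlift_none /= exprS mulNr addNr mul0r.
rewrite mxE /A unlift_none /= addr0 expr0 mul1r /cofactor expr0 mul1r.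
by congr (\det _); apply/matrixP => i j; rewrite !mxE liftK.
Qed.

Lemma colshiftC x y u : colshift x (colshift y u) = colshift y (colshift x u).
Proof. by apply/boolp.funext => l; apply/matrixP => i j; rewrite !mxE; ring. Qed.

(* Dividing [Q] by ['X + y] and by ['X + x] avoids inverting [x - y]. *)
Lemma Phi_divXD2 x y u Q n : (size Q <= n.+1)%N -> Phi u Q = 0 -> exists Q1 Q2,
  [/\ Q.[- y] *: colshift x u 0%N - Q.[- x] *: colshift y u 0%N
        + Phi (colshift y (colshift x u)) (Q1 - Q2) = 0,
      (size Q1 <= n)%N, (size Q2 <= n)%N,
      forall i, Q`_i.+1 = Q1`_i + y * Q1`_i.+1 &
      forall i, Q`_i.+1 = Q2`_i + x * Q2`_i.+1].
Proof.
move=> szQ PhiQ0.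
have Phi_shQ z : Phi (colshift z u) Q = Phi (u \o succn) Q.
  by rewrite -Phi_colshift mulrDr PhiD PhiMX mulrC mul_polyC PhiZ PhiQ0 scaler0 addr0.
have [Q1 [eq1 sz1 cf1]] := Phi_divXD y (colshift x u) szQ.
have [Q2 [eq2 sz2 cf2]] := Phi_divXD x (colshift y u) szQ.
exists Q1, Q2; split=> //; rewrite PhiB.
move: eq1 eq2; rewrite !Phi_shQ (colshiftC x y) => -> eq2.
by rewrite -addrACA -opprD -eq2 subrr.
Qed.

(** * The action of [K] and its quartic *)

Section Quartic.
Variables (e1 e2 e3 : R) (K : 'M[R]_N) (u : nat -> 'cV[R]_N).
Hypothesis uK : forall l,
  K *m u l = u l.+4 - e1 *: u l.+3 + e2 *: u l.+2 - e3 *: u l.+1.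

Definition quart (x : R) : R := x ^+ 4 - e1 * x ^+ 3 + e2 * x ^+ 2 - e3 * x.

(* Horner scheme for the quotient of [quart 'X - quart (- s)] by ['X + s]. *)
Definition quartdiv (s : R) : {poly R} :=
  let r2 := - e1 - s in let r1 := e2 - s * r2 in let r0 := - e3 - s * r1 in
  (('X + r2%:P) * 'X + r1%:P) * 'X + r0%:P.

(** The polynomial on the left is [Q] times the quartic, spelled out with factors ['X] so that
    [PhiMX] turns it into the index shifts of [uK]. *)
Lemma Phi_quart Q : Phi u
    (Q * 'X * 'X * 'X * 'X - e1 *: (Q * 'X * 'X * 'X) + e2 *: (Q * 'X * 'X)
       - e3 *: (Q * 'X)) = K *m Phi u Q.
Proof.
rewrite !(PhiB, PhiD, PhiZ) !PhiMX /Phi mulmx_sumr !scaler_sumr.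
rewrite -!(sumrB, big_split); apply: eq_bigr => i _ /=.
by rewrite -scalemxAr uK !(scalerBr, scalerDr) !scalerA ![_ * Q`_i]mulrC.
Qed.

(** Both [K *m Phi u Q] and [quart (- s) *: Phi u Q] vanish, so the kernel contains [Q] times the
    difference of the quartic and its value at [- s]; the factor ['X + s%:P] of that difference is
    passed to the columns. *)
Lemma Phi_quartdiv s Q : Phi u Q = 0 -> Phi (colshift s u) (Q * quartdiv s) = 0.
Proof.
move=> PhiQ0; rewrite -Phi_colshift.
have -> : Q * quartdiv s * ('X + s%:P) =
    (Q * 'X * 'X * 'X * 'X - e1 *: (Q * 'X * 'X * 'X) + e2 *: (Q * 'X * 'X)
       - e3 *: (Q * 'X)) - quart (- s) *: Q.
  by rewrite /quartdiv /quart -!mul_polyC !(rmorphB, rmorphD, rmorphM, rmorphN, rmorphXn) /=; ring.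
by rewrite PhiB PhiZ Phi_quart PhiQ0 mulmx0 scaler0 subrr.
Qed.

End Quartic.
End ColumnDet.

(** * Bilinear identities for N at least 2 *)

Section Bilinear.
Set Implicit Arguments. Unset Strict Implicit. Unset Printing Implicit Defensive.
Variables (R : comNzRingType) (M : nat).
Implicit Types (u psi : nat -> 'cV[R]_M.+2) (y : 'cV[R]_M.+2) (Q : {poly R}).

(* f, g, h and s at a point, with [N = M + 2]. *)
Definition fdet u := cdet u.
Definition gdet u := cdet (upd u M.+1 (u M.+2)).
Definition hdet u := cdet (upd u M.+1 (u M.+3)).
Definition sdet u := cdet (upd (upd u M.+1 (u M.+2)) M (u M.+1)).

(** Omitting index [M.+2], [M.+1] or [M] from 0, ..., M+2 leaves the index list of f, g or s
    respectively. *)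
Lemma kpoly_f u : (kpoly u)`_M.+2 = (-1) ^+ M * fdet u.
Proof.
rewrite coef_poly leqnn 2!exprS !mulN1r opprK; congr (_ * _).
by apply: eq_cdet => j ltj; rewrite /= /bump leqNgt ltj.
Qed.

Lemma kpoly_g u : (kpoly u)`_M.+1 = - ((-1) ^+ M * gdet u).
Proof.
rewrite coef_poly ltnW // exprS -mulrA mulN1r; congr (- (_ * _)).
apply: eq_cdet => j ltj; rewrite /= /bump /upd.
by have [->|nej] := eqVneq j M.+1; rewrite ?leqnn // leqNgt ltn_neqAle nej -ltnS ltj.
Qed.

Lemma kpoly_s u : (kpoly u)`_M = (-1) ^+ M * sdet u.
Proof.
rewrite coef_poly 2?ltnW //; congr (_ * _).
apply: eq_cdet => j; rewrite /= /bump /upd ltnS leq_eqVlt => /predU1P[->|].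
  by rewrite leqnSn gtn_eqF // eqxx.
rewrite ltnS leq_eqVlt => /predU1P[->|ltj]; first by rewrite leqnn eqxx.
by rewrite leqNgt ltj !ltn_eqF // ltnW.
Qed.

Lemma upd_id c k : upd c k (c k) = c :> (nat -> 'cV[R]_M.+2).
Proof. by apply/boolp.funext => j; rewrite /upd; case: eqP => // ->. Qed.

(** Linear functionals of [v] that turn a vanishing combination of columns into a scalar identity;
    in [det2] the last column [y] stays free. *)
Definition det1 psi v := cdet (upd psi M.+1 v).
Definition det2 psi y v := cdet (upd (upd psi M.+1 y) M v).

(** The column [u 0] allows the shift to be undone in all other columns: [cdet_colshift] with k =
    M+1. *)
Lemma det1_head s u : det1 (colshift s u) (u 0%N) = - ((-1) ^+ M * fdet u).
Proof.
rewrite -mulN1r mulrA -exprS; have := cdet_colshift s u u (ltnSn M.+1).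
rewrite (eq_cdet (c2 := upd (colshift s u) M.+1 (u 0%N))) => [|j ltj]; last first.
  by rewrite /upd; case: (ltngtP j M.+1) => // gtj; rewrite ltnNge gtj in ltj.
by rewrite /det1 => ->; congr (_ * _); apply: eq_cdet => j; rewrite ltnS => ->.
Qed.

(** The same with k = M, which leaves the last column [y] untouched. *)
Lemma det2_head s u y :
  det2 (colshift s u) y (u 0%N) = (-1) ^+ M * cdet (upd u M.+1 y).
Proof.
have := cdet_colshift s u (fun=> y) (ltnW (ltnSn M.+1)).
rewrite (eq_cdet (c2 := upd (upd (colshift s u) M.+1 y) M (u 0%N))) => [|j ltj]; last first.
  rewrite /upd; case: (ltngtP j M) => // ltMj; first by rewrite ltn_eqF // ltnS ltnW.
  by rewrite eqn_leq ltMj -ltnS ltj.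
rewrite /det2 => ->; congr (_ * _); apply: eq_cdet => j ltj.
rewrite /upd; case: (leqP j M) => [lejM|ltMj]; first by rewrite ltn_eqF.
by rewrite eqn_leq ltMj andbT -ltnS ltj.
Qed.

(** Monomials of degree at most [M] repeat a column already present; the size bound leaves only the
    three that produce f, g and h. *)
Lemma det1_Phi psi Q : (size Q <= M.+4)%N ->
  det1 psi (Phi psi Q) = Q`_M.+1 * fdet psi + Q`_M.+2 * gdet psi + Q`_M.+3 * hdet psi.
Proof.
move=> szQ; rewrite (PhiE _ szQ) /det1 cdet_upd_sum //.
under eq_bigr => i _ do rewrite cdet_updZ //.
rewrite 3!big_ord_recr /= big1 ?add0r => [|i _]; first by rewrite upd_id.
rewrite (@cdet_alt _ _ _ i M.+1) ?mulr0 // ?ltn_eqF //= ?(ltn_trans (ltn_ord i)) //.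
by rewrite /upd eqxx ltn_eqF.
Qed.

(** Degrees below [M] repeat a column and degree [M] restores [psi M]. The second determinant drops
    out in [bilinear_upd] and becomes s in [bilinear_fghs]. *)
Lemma det2_Phi psi y Q : (size Q <= M.+2)%N ->
  det2 psi y (Phi psi Q) = Q`_M * cdet (upd psi M.+1 y) + Q`_M.+1 * det2 psi y (psi M.+1).
Proof.
move=> szQ; rewrite (PhiE _ szQ) /det2 cdet_upd_sum //.
under eq_bigr => i _ do rewrite cdet_updZ //.
rewrite 2!big_ord_recr /= big1 ?add0r => [|i _].
  congr (_ * cdet _ + _).
  by rewrite -[RHS](upd_id _ M) [X in _ = upd _ M X]/upd (ltn_eqF (ltnSn M)).
rewrite (@cdet_alt _ _ _ i M) ?mulr0 // ?ltn_eqF //= ?(ltn_trans (ltn_ord i)) //.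
by rewrite /upd eqxx !ltn_eqF // ltnW // ltnS.
Qed.

Lemma cdet_upd_g s u : cdet (upd u M.+1 (colshift s u M.+1)) = gdet u + s * fdet u.
Proof. by rewrite cdet_updD // cdet_updZ // upd_id. Qed.

Lemma cdet_upd_h s u : cdet (upd u M.+1 (colshift s u M.+2)) = hdet u + s * gdet u.
Proof. by rewrite cdet_updD // cdet_updZ. Qed.

(** The relation of [Phi_divXD2] for [kpoly u], tested with [det2] at the doubly shifted point; the
    choice of [y] then selects the identity. *)
Lemma bilinear_upd (s t : R) u y :
  fdet (colshift t u) * cdet (upd (colshift s u) M.+1 y)
  - fdet (colshift s u) * cdet (upd (colshift t u) M.+1 y)
  + (s - t) * fdet u * cdet (upd (colshift t (colshift s u)) M.+1 y) = 0.
Proof.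
have [Q1 [Q2 [eq0 sz1 sz2 cf1 cf2]]] := Phi_divXD2 s t (size_poly _ _) (Phi_kpoly u).
have := congr1 (det2 (colshift t (colshift s u)) y) eq0.
rewrite -scaleN1r scalerA mulN1r /det2 !cdet_updD // !cdet_updZ // cdet_upd0 //.
rewrite -!/(det2 _ _ _) det2_head [in X in _ + X + _]colshiftC det2_head det2_Phi.
  rewrite !horner_kpoly; move: (cf1 M) (cf1 M.+1) (cf2 M) (cf2 M.+1).
  rewrite [Q1`_M.+2]nth_default // [Q2`_M.+2]nth_default // !mulr0 !addr0 kpoly_f.
  move=> q1 q1' q2 q2'; rewrite !coefB -q1' -q2' subrr mul0r addr0.
  (* Both quotients have coefficient (-1)^M f at [M.+1], so one degree lower they differ only
     through the division points. *)
  have -> : Q1`_M - Q2`_M = (-1) ^+ M * ((s - t) * fdet u).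
    rewrite -[Q1`_M](addrK (t * Q1`_M.+1)) -[Q2`_M](addrK (s * Q2`_M.+1)).
    by rewrite -q1 -q2 -q1' -q2'; ring.
  (* Multiplication by (-1)^M is an involution, so the overall sign can be cancelled. *)
  move=> eq; apply: (inv_inj (signrMK M)); rewrite mulr0 -[RHS]eq /fdet; ring.
by rewrite (leq_trans (size_polyD _ _)) // geq_max size_polyN sz1.
Qed.

Lemma bilinear_fg (s t : R) u :
  fdet (colshift s u) * (s * fdet (colshift t u) + gdet (colshift t u))
  - (s - t) * fdet u * fdet (colshift s (colshift t u))
  - (t * fdet (colshift s u) + gdet (colshift s u)) * fdet (colshift t u) = 0.
Proof.
(* The last column of the doubly shifted family: the third term becomes f there, the others expand
   into g and f. *)
have := bilinear_upd s t u (colshift t (colshift s u) M.+1).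
rewrite cdet_upd_g colshiftC cdet_upd_g upd_id -/(fdet _) => eq0.
by rewrite -[RHS]oppr0 -[in RHS]eq0; ring.
Qed.

Lemma bilinear_ff (s t : R) u :
  (s - t) * (fdet (colshift s u) * fdet (colshift t u)
             - fdet u * fdet (colshift s (colshift t u)))
  + fdet (colshift s u) * gdet (colshift t u)
  - fdet (colshift t u) * gdet (colshift s u) = 0.
Proof. by rewrite -[RHS](bilinear_fg s t u); ring. Qed.

Lemma bilinear_fgh (s t : R) u :
  fdet (colshift s u) * (t ^+ 2 * fdet (colshift t u) - t * gdet (colshift t u)
                        + hdet (colshift t u))
  + s * fdet (colshift s u) * (gdet (colshift t u) - t * fdet (colshift t u))
  - (s - t) * fdet u * (gdet (colshift s (colshift t u)) - t * fdet (colshift s (colshift t u)))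
  - fdet (colshift t u) * hdet (colshift s u) = 0.
Proof.
(* One column further brings in h; the discrepancy with the goal is [- t] times [bilinear_fg]. *)
have := bilinear_upd s t u (colshift t (colshift s u) M.+2).
rewrite cdet_upd_h colshiftC cdet_upd_h -/(gdet _) => eq0.
by rewrite -[RHS](mulr0 (- t)) -[in RHS](bilinear_fg s t u) -[LHS]addr0 -[in LHS]eq0; ring.
Qed.

Lemma bilinear_fghs (s : R) u :
  fdet (colshift s u) * (s * gdet u + hdet u) - gdet (colshift s u) * (s * fdet u + gdet u)
  + fdet u * sdet (colshift s u) = 0.
Proof.
have [Q1 [eq0 sz1 cf1]] := Phi_divXD s u (size_poly M.+3 (fun i => (-1) ^+ i * cdet (u \o bump i))).
(* With this [y] the remaining determinant of [det2_Phi] is s at the shifted point. *)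
have := congr1 (det2 (colshift s u) (colshift s u M.+2)) eq0.
rewrite Phi_kpoly /det2 !cdet_updD // !cdet_updZ // cdet_upd0 //.
rewrite -!/(det2 _ _ _) det2_head det2_Phi // cdet_upd_h horner_kpoly.
move: (cf1 M) (cf1 M.+1); rewrite [Q1`_M.+2]nth_default // mulr0 addr0 kpoly_f kpoly_g.
move=> /esym/(canRL (addrK _)) -> <- /esym eq; apply: (inv_inj (signrMK M)).
by rewrite mulr0 -[RHS]eq -/(gdet _) -/(sdet _) /det2 -/(sdet _) /fdet; ring.
Qed.

Lemma bilinear_quart (e1 e2 e3 : R) (K : 'M[R]_M.+2) (s t r : R) u :
  (forall l, K *m u l = u l.+4 - e1 *: u l.+3 + e2 *: u l.+2 - e3 *: u l.+1) ->
  let Q := (s + t) ^+ 2 - s * t + e1 * (s + t) + e2 in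
  let Rp (x y : R) := (x + y) * (x ^+ 2 + y ^+ 2) + e1 * ((x + y) ^+ 2 - x * y)
                + e2 * (x + y) + e3 in
  let w := colshift s (colshift t (colshift r u)) in
  (Q * fdet u * fdet w + sdet u * fdet w + (s + t + e1) * gdet u * fdet w
    - ((s + t + e1) * fdet u + gdet u) * (gdet w - r * fdet w)
    + fdet u * (hdet w - r * gdet w + r ^+ 2 * fdet w)) * (s - t)
  - Rp s r * fdet (colshift s u) * fdet (colshift t (colshift r u))
  + Rp t r * fdet (colshift t u) * fdet (colshift s (colshift r u)) = 0.
Proof.
move=> uK Q Rp w.
pose R4 := quartdiv e1 e2 e3 r.
(* [Rp x r] is, up to sign, the divided difference of the quartic at [- x] and [- r]. *)
have R4h x : R4.[- x] = - Rp x r.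
  rewrite /R4 /quartdiv !(hornerD, hornerM, hornerX, hornerC) /Rp; ring.
(* This gives a kernel relation based at [colshift r u]; dividing by the two other linear factors
   then reaches [w]. *)
have := Phi_quartdiv uK r (Phi_kpoly u); rewrite -/R4 => Phi0.
have k0 j : (M.+2 < j)%N -> (kpoly u)`_j = 0.
  by move=> ltj; rewrite nth_default // (leq_trans (size_poly _ _)).
have cQ j : (kpoly u * R4)`_j.+3 = (kpoly u)`_j + (- e1 - r) * (kpoly u)`_j.+1
   + (e2 - r * (- e1 - r)) * (kpoly u)`_j.+2
   + (- e3 - r * (e2 - r * (- e1 - r))) * (kpoly u)`_j.+3.
  rewrite /R4 /quartdiv !(mulrDr, mulrA, mulrDl) !coefD !(coefMC, coefMX) /=.
  by ring.
have szQ : (size (kpoly u * R4)%R <= M.+4.+2)%N.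
  apply/leq_sizeP => -[|[|[|j]]] // lej.
  by rewrite cQ !k0 ?mulr0 ?addr0 // !leqW.
have [Q1 [Q2 [eq0 sz1 sz2 cf1 cf2]]] := Phi_divXD2 s t szQ Phi0.
have szT : (size (Q1 - Q2)%R <= M.+4)%N.
  apply/leq_sizeP => j; rewrite leq_eqVlt => /predU1P[<-|ltj]; last first.
    by rewrite coefB !nth_default ?subrr // (leq_trans _ ltj).
  move: (cf1 M.+4) (cf2 M.+4).
  rewrite [Q1`_M.+4.+1]nth_default // [Q2`_M.+4.+1]nth_default // !mulr0 !addr0.
  by rewrite coefB => <- <-; rewrite subrr.
have := congr1 (det1 (colshift t (colshift s (colshift r u)))) eq0.
rewrite -scaleN1r scalerA mulN1r /det1 !cdet_updD // !cdet_updZ // cdet_upd0 //.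
rewrite -!/(det1 _ _) det1_head [in X in _ + X + _]colshiftC det1_head det1_Phi //.
rewrite !hornerM !horner_kpoly !R4h (colshiftC t s) -/w !coefB.
move: (cf1 M.+1) (cf1 M.+2) (cf1 M.+3) (cf1 M.+4) (cf2 M.+1) (cf2 M.+2) (cf2 M.+3) (cf2 M.+4).
rewrite [Q1`_M.+4.+1]nth_default // [Q2`_M.+4.+1]nth_default // !mulr0 !addr0.
have [k3 k4 k5] : [/\ (kpoly u)`_M.+3 = 0, (kpoly u)`_M.+4 = 0
                    & (kpoly u)`_M.+4.+1 = 0].
  by split; apply: k0; rewrite !ltnS ?leqW.
rewrite !cQ k3 k4 k5 !mulr0 !addr0 kpoly_f kpoly_g kpoly_s.
(* Each relation expresses a quotient coefficient through the next higher one, down to the known top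
   coefficient. *)
do 3!move=> /esym/(canRL (addrK _)) ->; move=> <-.
do 3!move=> /esym/(canRL (addrK _)) ->; move=> <- eq.
by apply: (inv_inj (signrMK M)); rewrite mulr0 -[RHS]eq /fdet /Q /w; ring.
Qed.

End Bilinear.

(** * The case N = 1, where columns are scalars *)

Section Size1.
Set Implicit Arguments. Unset Strict Implicit. Unset Printing Implicit Defensive.
Variable R : comNzRingType.
Implicit Types (s t r : R) (u : nat -> 'cV[R]_1).

Definition ent u l : R := u l 0 0.

Lemma ent_colshift s u l : ent (colshift s u) l = ent u l.+1 + s * ent u l.
Proof. by rewrite /ent !mxE. Qed.

Lemma size1_fg s t u :
  ent (colshift s u) 0 * (s * ent (colshift t u) 0 + ent (colshift t u) 1)
  - (s - t) * ent u 0 * ent (colshift s (colshift t u)) 0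
  - (t * ent (colshift s u) 0 + ent (colshift s u) 1) * ent (colshift t u) 0 = 0.
Proof. by rewrite !ent_colshift; ring. Qed.

Lemma size1_ff s t u :
  (s - t) * (ent (colshift s u) 0 * ent (colshift t u) 0
             - ent u 0 * ent (colshift s (colshift t u)) 0)
  + ent (colshift s u) 0 * ent (colshift t u) 1
  - ent (colshift t u) 0 * ent (colshift s u) 1 = 0.
Proof. by rewrite !ent_colshift; ring. Qed.

Lemma size1_fgh s t u :
  ent (colshift s u) 0 * (t ^+ 2 * ent (colshift t u) 0 - t * ent (colshift t u) 1
                           + ent (colshift t u) 2)
  + s * ent (colshift s u) 0 * (ent (colshift t u) 1 - t * ent (colshift t u) 0)
  - (s - t) * ent u 0 * (ent (colshift s (colshift t u)) 1 - t * ent (colshift s (colshift t u)) 0)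
  - ent (colshift t u) 0 * ent (colshift s u) 2 = 0.
Proof. by rewrite !ent_colshift; ring. Qed.

(** The literal 0 stands for s, which lists two indices and so vanishes for N = 1. *)
Lemma size1_fghs s u :
  ent (colshift s u) 0 * (s * ent u 1 + ent u 2) - ent (colshift s u) 1 * (s * ent u 0 + ent u 1)
  + ent u 0 * 0 = 0.
Proof. by rewrite !ent_colshift; ring. Qed.

Lemma size1_quart (e1 e2 e3 : R) (K : 'M[R]_1) s t r u :
  (forall l, K *m u l = u l.+4 - e1 *: u l.+3 + e2 *: u l.+2 - e3 *: u l.+1) ->
  let Q := (s + t) ^+ 2 - s * t + e1 * (s + t) + e2 in
  let Rp (x y : R) := (x + y) * (x ^+ 2 + y ^+ 2) + e1 * ((x + y) ^+ 2 - x * y)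
                + e2 * (x + y) + e3 in
  let w := colshift s (colshift t (colshift r u)) in
  (Q * ent u 0 * ent w 0 + 0 * ent w 0 + (s + t + e1) * ent u 1 * ent w 0
    - ((s + t + e1) * ent u 0 + ent u 1) * (ent w 1 - r * ent w 0)
    + ent u 0 * (ent w 2 - r * ent w 1 + r ^+ 2 * ent w 0)) * (s - t)
  - Rp s r * ent (colshift s u) 0 * ent (colshift t (colshift r u)) 0
  + Rp t r * ent (colshift t u) 0 * ent (colshift s (colshift r u)) 0 = 0.
Proof.
move=> uK Q Rp w.
have entK l : K 0 0 * ent u l =
    ent u l.+4 - e1 * ent u l.+3 + e2 * ent u l.+2 - e3 * ent u l.+1.
  by have := congr1 (fun A : 'cV_1 => A 0 0) (uK l); rewrite !mxE big_ord1.
(* Lowering every index of at least four turns the goal into a polynomial identity in the first four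
   entries and [K 0 0]. *)
have ent4 l : ent u l.+4 =
    K 0 0 * ent u l + e1 * ent u l.+3 - e2 * ent u l.+2 + e3 * ent u l.+1.
  by rewrite entK; ring.
by rewrite /w /Q /Rp !ent_colshift !ent4; ring.
Qed.

End Size1.

(** * From Casoratians of phi to column determinants *)

Section Casoratians.
Set Implicit Arguments. Unset Strict Implicit. Unset Printing Implicit Defensive.
Variable R : realType.
Local Notation C := (complex R).
Implicit Types (n m al be : int).

Definition colseq N (phi : int -> int -> int -> int -> int -> 'cV[C]_N) n m al be :
  nat -> 'cV[C]_N := fun l => phi n m al be l%:Z.

Lemma size_run k : size (run k) = k.
Proof. by rewrite size_map size_iota. Qed.

Lemma nth_run k j : (j < k)%N -> nth 0 (run k) j = j%:Z.
Proof. by move=> ltj; rewrite (nth_map 0%N) ?size_iota // nth_iota. Qed.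

Lemma casorE N (phi : int -> int -> int -> int -> int -> 'cV[C]_N) n m al be s c :
  size s = N -> (forall j, (j < N)%N -> phi n m al be (nth 0 s j) = c j) ->
  casor phi n m al be s = cdet c.
Proof.
move=> szs eqc; rewrite /casor szs eqxx.
by apply: (eq_cdet (c1 := fun j => phi n m al be (nth 0 s j))).
Qed.

Section Size2.
Variables (M : nat) (phi : int -> int -> int -> int -> int -> 'cV[C]_M.+2).

Lemma fCE n m al be : fC phi n m al be = fdet (colseq phi n m al be).
Proof. by apply: casorE => [|j ltj]; rewrite ?size_run ?nth_run. Qed.

Lemma gCE n m al be : gC phi n m al be = gdet (colseq phi n m al be).
Proof.
apply: casorE => [|j]; first by rewrite size_cat size_run addn1.
rewrite ltnS leq_eqVlt nth_cat size_run /upd => /predU1P[->|ltj].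
  by rewrite ltnn subnn eqxx.
by rewrite ltj nth_run // ltn_eqF.
Qed.

Lemma hCE n m al be : hC phi n m al be = hdet (colseq phi n m al be).
Proof.
apply: casorE => [|j]; first by rewrite size_cat size_run addn1.
rewrite ltnS leq_eqVlt nth_cat size_run /upd => /predU1P[->|ltj].
  by rewrite ltnn subnn eqxx /= -PoszD addn1.
by rewrite ltj nth_run // ltn_eqF.
Qed.

Lemma sCE n m al be : sC phi n m al be = sdet (colseq phi n m al be).
Proof.
apply: casorE => [|j]; first by rewrite size_cat size_run addn2.
rewrite ltnS leq_eqVlt nth_cat size_run /upd => /predU1P[->|].
  by rewrite ltnNge leqnSn subSnn gtn_eqF // eqxx.
rewrite ltnS leq_eqVlt => /predU1P[->|ltj].
  rewrite ltnn subnn eqxx /=.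
  by have -> : (M.+2)%:Z - 1 = M.+1 by rewrite -[M.+2]addn1 PoszD addrK.
by rewrite ltj nth_run // !ltn_eqF // ltnS ltnW.
Qed.

End Size2.
End Casoratians.

Theorem theorem4p4 (R : realType) (N : nat)
  (p q a b delta alpha1 alpha2 alpha3 : complex R)
  (phi : int -> int -> int -> int -> int -> 'cV[complex R]_N)
  (K : 'M[complex R]_N) :
  uniq [:: p; q; a; b] ->
  let s1 := p - delta in let s2 := q - delta in
  let s3 := a - delta in let s4 := b - delta in
  let e1 := eps1 alpha3 delta in
  let e2 := eps2 alpha2 alpha3 delta in
  let e3 := eps3 alpha1 alpha2 alpha3 delta in
  (forall n m al be l,
     s1 *: phi (n - 1) m al be l = phi n m al be l - phi (n - 1) m al be (l + 1)) ->
  (forall n m al be l,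
     s2 *: phi n (m - 1) al be l = phi n m al be l - phi n (m - 1) al be (l + 1)) ->
  (forall n m al be l,
     s3 *: phi n m (al - 1) be l = phi n m al be l - phi n m (al - 1) be (l + 1)) ->
  (forall n m al be l,
     s4 *: phi n m al (be - 1) l = phi n m al be l - phi n m al (be - 1) (l + 1)) ->
  (forall n m al be l,
     K *m phi n m al be l =
       phi n m al be (l + 4) - e1 *: phi n m al be (l + 3)
       + e2 *: phi n m al be (l + 2) - e3 *: phi n m al be (l + 1)) ->
  forall n m al be : int,
  (* plain, tilde (n+1), hat (m+1), dot (be+1) and their compositions *)
  let f := fC phi n m al be in
  let ft := fC phi (n + 1) m al be in
  let fh := fC phi n (m + 1) al be in
  let fd := fC phi n m al (be + 1) in
  let fth := fC phi (n + 1) (m + 1) al be in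
  let ftd := fC phi (n + 1) m al (be + 1) in
  let fhd := fC phi n (m + 1) al (be + 1) in
  let fthd := fC phi (n + 1) (m + 1) al (be + 1) in
  let g := gC phi n m al be in
  let gt := gC phi (n + 1) m al be in
  let gh := gC phi n (m + 1) al be in
  let gd := gC phi n m al (be + 1) in
  let gtd := gC phi (n + 1) m al (be + 1) in
  let ghd := gC phi n (m + 1) al (be + 1) in
  let gthd := gC phi (n + 1) (m + 1) al (be + 1) in
  let h := hC phi n m al be in
  let ht := hC phi (n + 1) m al be in
  let hh := hC phi n (m + 1) al be in
  let hd := hC phi n m al (be + 1) in
  let hthd := hC phi (n + 1) (m + 1) al (be + 1) in
  let s := sC phi n m al be in
  let st := sC phi (n + 1) m al be in
  let sh := sC phi n (m + 1) al be in
  (ft * (s1 * fd + gd) - (s1 - s4) * f * ftd - (s4 * ft + gt) * fd = 0) /\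
      (      fh * (s2 * fd + gd) - (s2 - s4) * f * fhd - (s4 * fh + gh) * fd = 0) /\
      (      ft * (s4 ^+ 2 * fd - s4 * gd + hd) + s1 * ft * (gd - s4 * fd)
        - (s1 - s4) * f * (gtd - s4 * ftd) - fd * ht = 0) /\
      (      fh * (s4 ^+ 2 * fd - s4 * gd + hd) + s2 * fh * (gd - s4 * fd)
        - (s2 - s4) * f * (ghd - s4 * fhd) - fd * hh = 0) /\
      (      ft * (s1 * g + h) - gt * (s1 * f + g) + f * st = 0) /\
      (      fh * (s2 * g + h) - gh * (s2 * f + g) + f * sh = 0) /\
      (      (s1 - s2) * (ft * fh - f * fth) + ft * gh - fh * gt = 0) /\
      ((Qpoly e1 e2 s1 s2 * f * fthd + s * fthd + (s1 + s2 + e1) * g * fthd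
        - ((s1 + s2 + e1) * f + g) * (gthd - s4 * fthd)
        + f * (hthd - s4 * gthd + s4 ^+ 2 * fthd)) * (s1 - s2)
      - Rpoly e1 e2 e3 s1 s4 * ft * fhd + Rpoly e1 e2 e3 s2 s4 * fh * ftd = 0).
Proof.
move=> _ s1 s2 s3 s4 e1 e2 e3 sh1 sh2 _ sh4 phiK n m al be.
(* Each condition equation, read at the advanced argument, says that the advance acts on columns as
   [colshift]. *)
have U1 n' m' be' : colseq phi (n' + 1) m' al be' = colshift s1 (colseq phi n' m' al be').
  apply/boolp.funext => l; have := sh1 (n' + 1) m' al be' l%:Z.
  by rewrite addrK /colshift /colseq => ->; rewrite -PoszD addn1 subrKC.
have U2 n' m' be' : colseq phi n' (m' + 1) al be' = colshift s2 (colseq phi n' m' al be').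
  apply/boolp.funext => l; have := sh2 n' (m' + 1) al be' l%:Z.
  by rewrite addrK /colshift /colseq => ->; rewrite -PoszD addn1 subrKC.
have U4 n' m' be' : colseq phi n' m' al (be' + 1) = colshift s4 (colseq phi n' m' al be').
  apply/boolp.funext => l; have := sh4 n' m' al (be' + 1) l%:Z.
  by rewrite addrK /colshift /colseq => ->; rewrite -PoszD addn1 subrKC.
pose u := colseq phi n m al be.
have uK l : K *m u l = u l.+4 - e1 *: u l.+3 + e2 *: u l.+2 - e3 *: u l.+1.
  by rewrite /u /colseq phiK -!PoszD addn4 addn3 addn2 addn1.
case: N phi K {sh1 sh2 sh4 phiK} U1 U2 U4 @u uK => [|[|M]] phi K U1 U2 U4 u uK.
(* For N = 0, f is the empty determinant 1, while g, h and s list too many indices and are 0. *)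
- rewrite /fC /gC /hC /sC /casor /= !det_mx00 /Qpoly /Rpoly.
  by do !split; ring.
- have fE n' m' be' : fC phi n' m' al be' = ent (colseq phi n' m' al be') 0.
    by rewrite /fC /casor /= det_mx11 mxE.
  have gE n' m' be' : gC phi n' m' al be' = ent (colseq phi n' m' al be') 1.
    by rewrite /gC /casor /= det_mx11 mxE.
  have hE n' m' be' : hC phi n' m' al be' = ent (colseq phi n' m' al be') 2.
    by rewrite /hC /casor /= det_mx11 mxE.
  have sE n' m' be' : sC phi n' m' al be' = 0 by [].
  cbv zeta; rewrite !(fE, gE, hE, sE, U1, U2, U4) -/u.
  split; [exact: size1_fg|split; [exact: size1_fg|]].
  split; [exact: size1_fgh|split; [exact: size1_fgh|]].
  split; [exact: size1_fghs|split; [exact: size1_fghs|]].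
  by split; [exact: size1_ff|exact: (size1_quart s1 s2 s4 uK)].
cbv zeta; rewrite !(fCE, gCE, hCE, sCE, U1, U2, U4) -/u.
split; [exact: bilinear_fg|split; [exact: bilinear_fg|]].
split; [exact: bilinear_fgh|split; [exact: bilinear_fgh|]].
split; [exact: bilinear_fghs|split; [exact: bilinear_fghs|]].
by split; [exact: bilinear_ff|exact: (bilinear_quart s1 s2 s4 uK)].
Qed.
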